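(* Let $\mathcal E$ be a finite set of edge-colored graphs with the following properties: (1) the class of $\mathcal E$-free edge-colored graphs is closed under amalgamation over vertices: whenever $(G_1,\gamma_1)$ and $(G_2,\gamma_2)$ are $\mathcal E$-free and $v_1\in V(G_1)$, $v_2\in V(G_2)$, the edge-colored graph obtained from their disjoint union by identifying $v_1$ and $v_2$ is $\mathcal E$-free; (2) for every $K\ge 1$ there exists a finite graph $G$ that admits no $\mathcal E$-free edge-coloring, but every subgraph of $G$ with at most $K$ vertices admits an $\mathcal E$-free edge-coloring. Then there is no finite set $\mathcal F$ of vertex-colored graphs such that $\mathrm{Col}(\mathcal F)=\mathrm{Col}(\mathcal E)$, i.e., such that a finite graph admits an $\mathcal F$-free vertex-coloring if and only if it admits an $\mathcal E$-free edge-coloring.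
   Context: Graphs are finite simple undirected. Edge colors come from a fixed finite set. An edge-colored graph is $(G,\gamma)$ with $\gamma$ a map from $E(G)$ to the colors; $(G,\gamma)$ is $\mathcal E$-free if there is no $(E,\theta)\in\mathcal E$ and graph homomorphism $h\colon E\to G$ with $\gamma(h(e))=\theta(e)$ for all edges $e$ of $E$; an $\mathcal E$-free edge-coloring of $G$ is a $\gamma$ with $(G,\gamma)$ $\mathcal E$-free, and $\mathrm{Col}(\mathcal E)$ is the class/problem of finite graphs admitting one. Analogously, for a finite set $\mathcal F$ of vertex-colored graphs $(F,\phi)$ ($\phi$ maps vertices to a fixed finite set of colors), a vertex-coloring $\chi$ of $G$ is $\mathcal F$-free if no $(F,\phi)\in\mathcal F$ admits a homomorphism $h\colon F\to G$ with $\chi\circ h=\phi$; $\mathrm{Col}(\mathcal F)$ is the class of finite graphs admitting an $\mathcal F$-free vertex-coloring. *)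

(* Defs.v *)
From mathcomp Require Import all_boot.
From Stdlib Require List.
Set Implicit Arguments. Unset Strict Implicit. Unset Printing Implicit Defensive.

Record graph := Graph {
  gV : finType;
  gadj : rel gV;
  gsym : symmetric gadj;
  girr : irreflexive gadj }.
Arguments gadj : clear implicits.

Definition ghom (G H : graph) (h : gV G -> gV H) : Prop :=
  forall x y, gadj G x y -> gadj H (h x) (h y).

Definition subgraph (H G : graph) : Prop :=
  exists f : gV H -> gV G, injective f /\ ghom f.

(* Edges, as ordered adjacent pairs; an unordered edge {x,y} appears as both
   (x,y) and (y,x), and colourings are required to agree on both. *)
Definition edge (G : graph) := {p : gV G * gV G | gadj G p.1 p.2}.

Section EdgeColoured.
Variable C : Type.

Definition ec_sym (G : graph) (gam : edge G -> C) : Prop :=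
  forall e f : edge G, (val e).1 = (val f).2 -> (val e).2 = (val f).1 ->
    gam e = gam f.

Record ecgraph := ECGraph {
  eg : graph;
  ecol : edge eg -> C;
  ecol_sym : ec_sym ecol }.
Arguments ecol : clear implicits.

Definition ec_hom_into (E : ecgraph) (G : graph) (gam : edge G -> C) : Prop :=
  exists h : gV (eg E) -> gV G, ghom h /\
    forall (e : edge (eg E)) (e' : edge G),
      val e' = (h (val e).1, h (val e).2) -> gam e' = ecol E e.

Definition ec_free (Es : list ecgraph) (G : graph) (gam : edge G -> C) : Prop :=
  forall E, List.In E Es -> ~ ec_hom_into E gam.

Definition ColE (Es : list ecgraph) (G : graph) : Prop :=
  exists gam : edge G -> C, ec_sym gam /\ ec_free Es gam.
End EdgeColoured.
Arguments ecol {C} _ _.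

Section VertexColoured.
Variable D : Type.

Record vcgraph := VCGraph { vg : graph; vcol : gV vg -> D }.
Arguments vcol : clear implicits.

Definition vc_free (Fs : list vcgraph) (G : graph) (chi : gV G -> D) : Prop :=
  forall F, List.In F Fs -> ~ exists h : gV (vg F) -> gV G,
    ghom h /\ forall x, chi (h x) = vcol F x.

Definition ColF (Fs : list vcgraph) (G : graph) : Prop :=
  exists chi : gV G -> D, vc_free Fs chi.
End VertexColoured.
Arguments vcol {D} _ _.

Section Amalgam.
Variables (G1 G2 : graph) (v1 : gV G1) (v2 : gV G2).

Definition amal_V : finType := (gV G1 + {x : gV G2 | x != v2})%type.

Definition emb1 (x : gV G1) : amal_V := inl x.
Definition emb2 (x : gV G2) : amal_V :=
  if insub x is Some y then inr y else inl v1.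

Lemma emb2_inj : injective emb2.
Proof.
move=> x y; rewrite /emb2.
case: insubP => [x' nx <-|/negPn/eqP ->]; case: insubP => [y' ny <-|/negPn/eqP ->] //=.
- by case=> ->.
Qed.

Definition amal_adj : rel amal_V := fun a b =>
  [exists x, exists y, [&& gadj G1 x y, a == emb1 x & b == emb1 y]] ||
  [exists x, exists y, [&& gadj G2 x y, a == emb2 x & b == emb2 y]].

Lemma amal_sym : symmetric amal_adj.
Proof.
suff H : forall a b, amal_adj a b -> amal_adj b a.
  by move=> a b; apply/idP/idP => /H.
move=> a b /orP [/existsP [x /existsP [y /and3P [hxy ha hb]]]
               |/existsP [x /existsP [y /and3P [hxy ha hb]]]].
- apply/orP; left; apply/existsP; exists y; apply/existsP; exists x.
  by rewrite gsym hxy ha hb.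
- apply/orP; right; apply/existsP; exists y; apply/existsP; exists x.
  by rewrite gsym hxy ha hb.
Qed.

Lemma amal_irr : irreflexive amal_adj.
Proof.
move=> a; apply/negbTE/negP => /orP [/existsP [x /existsP [y /and3P [hxy /eqP ha /eqP hb]]]
                         |/existsP [x /existsP [y /and3P [hxy /eqP ha /eqP hb]]]].
- move: ha; rewrite hb => -[] exy; by rewrite exy girr in hxy.
- move: ha; rewrite hb => /emb2_inj exy; by rewrite exy girr in hxy.
Qed.

Definition amalgam : graph := Graph amal_sym amal_irr.

(* gam colours amalgam consistently with gam1 on G1 and gam2 on G2
   (this determines gam uniquely) *)
Definition amal_col {C : Type} (gam1 : edge G1 -> C) (gam2 : edge G2 -> C)
  (gam : edge amalgam -> C) : Prop :=
  (forall (e1 : edge G1) (e : edge amalgam),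
     val e = (emb1 (val e1).1, emb1 (val e1).2) -> gam e = gam1 e1) /\
  (forall (e2 : edge G2) (e : edge amalgam),
     val e = (emb2 (val e2).1, emb2 (val e2).2) -> gam e = gam2 e2).
End Amalgam.

(* Main.v *)
Require Import Defs.
From mathcomp Require Import all_boot zify.
From Stdlib Require List.
Set Implicit Arguments. Unset Strict Implicit. Unset Printing Implicit Defensive.

(* Take G without an E-free edge-colouring all of whose subgraphs on few vertices
   have one.  A hypergraph of large girth is used to spread many copies of the small
   induced subgraphs of G so that (i) every vertex-colouring chi of the resulting
   graph W admits a vertex-colouring chi0 of G such that each small induced subgraph
   of G, coloured by chi0, occurs in W.  A forbidden F exists in G for chi0, hence in
   W for chi: W has no F-free vertex-colouring.  (ii) A homomorphic image of a
   forbidden E meets few copies, which hang together like a forest, so colouring each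
   copy separately gives an E-free edge-colouring of W by closure under amalgamation.
   The hypergraphs come from the partite construction of Nesetril and Roedl. *)

(** * Sparse hypergraphs *)

(* The sum equals [\sum_(i in T) #|e i| - #|\bigcup_(i in T) e i|], so this says that
   any at most [g] edges form a Berge-acyclic hypergraph. *)
Definition sparse (g : nat) (V I : finType) (e : I -> {set V}) : Prop :=
  forall T : {set I}, 0 < #|T| <= g ->
    \sum_v ((\sum_(i in T) (v \in e i)) - 1) < #|T|.

(** Otherwise every edge of [T] has two vertices of degree d >= 2 in [T]; as d <= 2(d - 1), double
    counting gives excess at least [#|T|]. *)
Lemma sparse_leaf (g : nat) (V I : finType) (e : I -> {set V}) (T : {set I}) :
  sparse g e -> 0 < #|T| <= g ->
  exists2 i, i \in T & #|e i :&: \bigcup_(j in T :\ i) e j| <= 1.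
Proof.
move=> sp hT; have /= := sp T hT.
case: (boolP [exists i in T, #|e i :&: \bigcup_(j in T :\ i) e j| <= 1]).
  by case/exists_inP=> i iT hi _; exists i.
rewrite negb_exists_in => /forall_inP big; rewrite ltnNge => /negP[].
suff: \sum_(i in T) 2 <= \sum_v 2 * ((\sum_(i in T) (v \in e i)) - 1).
  by rewrite sum_nat_const -big_distrr /= mulnC leq_pmul2l.
apply: (@leq_trans (\sum_(i in T) #|e i :&: \bigcup_(j in T :\ i) e j|)).
  by apply: leq_sum => i iT; rewrite ltnNge big.
under eq_bigr => i _ do rewrite -sum1_card big_mkcond /=.
rewrite exchange_big /=; apply: leq_sum => v _.
case: (leqP (\sum_(i in T) (v \in e i)) 1) => [le1|gt1]; last first.
  apply: (@leq_trans (\sum_(i in T) (v \in e i))); last by lia.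
  by apply: leq_sum => i _; rewrite inE; case: (v \in e i); case: (v \in _).
rewrite big1 // => i iT; case: ifP => //; rewrite inE => /andP[vi /bigcupP[j]].
rewrite in_setD1 => /andP[ji jT] vj; move: le1.
by rewrite (bigD1 i) //= (bigD1 j) /= ?jT ?vi ?vj.
Qed.

Lemma sum_imset_excess (V V' I : finType) (f : V -> V') (e : I -> {set V})
    (T : {set I}) : injective f ->
  \sum_v' ((\sum_(i in T) (v' \in f @: e i)) - 1) =
  \sum_v ((\sum_(i in T) (v \in e i)) - 1).
Proof.
move=> fI; rewrite (bigID (mem (f @: [set: V]))) /= [X in _ + X]big1 ?addn0.
  rewrite big_imset /=; last by move=> x y _ _ /fI.
  rewrite big_mkcond; apply: eq_bigr => v _; rewrite inE.
  by congr (_ - _); apply: eq_bigr => i _; rewrite mem_imset.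
move=> v' nv'; rewrite big1 // => i _; apply/eqP; rewrite eqb0.
by apply: contra nv' => /imsetP[x _ ->]; rewrite imset_f.
Qed.

(** Used to glue a part of a partite system onto a hypergraph edge; [None] marks the vertices left
    unglued. *)
Lemma set_encoding (X Y : finType) (A : {set X}) (B : {set Y}) : #|A| = #|B| ->
  exists b : X -> option Y,
    [/\ forall x, isSome (b x) = (x \in A),
        forall x y, b x = Some y -> y \in B &
        forall x x' y, b x = Some y -> b x' = Some y -> x = x'].
Proof.
move=> AB; pose b x := if x \in A then onth (enum B) (index x (enum A)) else None.
have bP x y : b x = Some y ->
    [/\ x \in A, y \in B & index x (enum A) = index y (enum B)].
  rewrite /b; case: ifP => // xA bx; have := @onth_nth _ y y _ _ bx.
  have lt : index x (enum A) < size (enum B) by rewrite -onthTE bx.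
  by move=> <-; rewrite index_uniq ?enum_uniq // -mem_enum mem_nth.
exists b; split=> [x|x y /bP[]//|x x' y /bP[xA _ ex] /bP[x'A _ ex']].
  rewrite /b; case: ifP => // xA.
  by rewrite onthTE -cardE -AB cardE index_mem mem_enum.
rewrite -(nth_index x (s := enum A) (x := x)) ?mem_enum // ex -ex'.
by rewrite nth_index ?mem_enum.
Qed.

(** Splits the excess at a vertex into the excess inside each copy and the excess of the number of
    copies that reach it. *)
Lemma subn1_sum_le (K : finType) (a : K -> nat) :
  \sum_k a k - 1 <= \sum_k (a k - 1) + (\sum_k (0 < a k) - 1).
Proof.
have -> : \sum_k a k = \sum_k (a k - 1) + \sum_k (0 < a k).
  by rewrite -big_split; apply: eq_bigr => k _; case: (a k) => //= m; lia.
case E: (\sum_k (0 < a k)) => [|m]; last by lia.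
by rewrite addn0 leq_subr.
Qed.

(** * The partite construction *)

Definition monochromatic_hypergraph (D : finType) (g p : nat) : Prop :=
  exists (W I : finType) (e : I -> {set W}),
    [/\ forall i, #|e i| = p, sparse g e &
        forall chi : W -> D, exists i c, forall w, w \in e i -> chi w = c].

(* [N] indexes the parts, [pi] sends a vertex to its part, and an edge of type [j] is
   a transversal of the parts in [S j]; [l] lists the parts already treated. *)
Definition partite_system (D N J : finType) (S : J -> {set N}) (g : nat)
    (l : seq N) : Prop :=
  exists (V I : finType) (pi : V -> N) (tau : I -> J) (e : I -> {set V}),
    [/\ forall i, {in e i &, injective pi},
        forall i, pi @: e i = S (tau i), sparse g e &
        forall chi : V -> D, exists f : J -> I, (forall j, tau (f j) = j) /\
          forall n, n \in l ->
            exists c, forall j x, x \in e (f j) -> pi x = n -> chi x = c].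

Section Glue.
Variables (V I W K : finType) (e : I -> {set V}) (b : K -> V -> option W).

Definition glue_vertex (k : K) (x : V) : W + K * V :=
  if b k x is Some w then inl w else inr (k, x).

Definition glue_edge (q : K * I) : {set W + K * V} := glue_vertex q.1 @: e q.2.

Hypothesis b_inj : forall k x x' w, b k x = Some w -> b k x' = Some w -> x = x'.

Lemma glue_vertex_inj (k : K) : injective (glue_vertex k).
Proof.
move=> x y; rewrite /glue_vertex.
case Ex: (b k x) => [w|]; case Ey: (b k y) => [w'|] //; last by case.
by case=> ww'; apply: (b_inj Ex); rewrite ww'.
Qed.

Lemma glue_edge_inl (w : W) (q : K * I) : inl w \in glue_edge q ->
  exists2 x, x \in e q.2 & b q.1 x = Some w.
Proof.
case/imsetP=> x xe; rewrite /glue_vertex.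
by case Ex: (b q.1 x) => [w'|] // [->]; exists x.
Qed.

Lemma glue_edge_inr (k : K) (x : V) (q : K * I) :
  inr (k, x) \in glue_edge q -> q.1 = k.
Proof.
by case/imsetP=> y ye; rewrite /glue_vertex; case: (b q.1 y) => // -[->].
Qed.

Variables (g : nat) (eh : K -> {set W}).
Hypothesis b_mem : forall k x w, b k x = Some w -> w \in eh k.
Hypothesis b_edge : forall k i x y,
  x \in e i -> y \in e i -> b k x -> b k y -> x = y.

(* A set of at most g + 1 edges meeting more than g copies has one edge in each of
   them, and that edge has at most one shared vertex; otherwise the sparsity of
   the copies and of [eh] add up. *)
Lemma glue_sparse : sparse g.+1 e -> sparse g eh -> sparse g.+1 glue_edge.
Proof.
move=> spe sph T /andP[T0 Tg].
pose Tk k := [set i | (k, i) \in T].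
pose T' := [set k | 0 < #|Tk k|].
pose a k v := \sum_(i in Tk k) (v \in glue_edge (k, i)).
have sumT (F : K * I -> nat) : \sum_(q in T) F q = \sum_k \sum_(i in Tk k) F (k, i).
  rewrite pair_big_dep; apply: eq_big => [[k i]|[k i] _] //=.
  by rewrite inE.
have cardT : #|T| = \sum_(k in T') #|Tk k|.
  rewrite -sum1_card sumT [RHS]big_mkcond /=; apply: eq_bigr => k _.
  by rewrite sum1_card inE; case: posnP.
have a0 k v : k \notin T' -> a k v = 0.
  rewrite inE -leqNgt leqn0 cards_eq0 => /eqP T0'.
  by rewrite /a T0' big_set0.
(* Sparsity of [e] saves one edge in every copy that [T] meets. *)
have copies : \sum_k \sum_v (a k v - 1) <= #|T| - #|T'|.
  have -> : #|T| - #|T'| = \sum_(k in T') (#|Tk k| - 1).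
    rewrite cardT -[#|T'|]sum1_card -sumnB // => k.
    by rewrite inE.
  rewrite [X in _ <= X]big_mkcond /=; apply: leq_sum => k _; case: ifP => kT.
    rewrite /a (sum_imset_excess _ _ (@glue_vertex_inj k)).
    have kT0 : 0 < #|Tk k| by move: kT; rewrite inE.
    have lT : #|Tk k| <= g.+1.
      by apply: leq_trans Tg; rewrite cardT (bigD1 k) //= leq_addr.
    by rewrite [X in _ <= X]subn1 -ltnS prednK //; apply: spe; rewrite kT0.
  by rewrite big1 // => v _; rewrite a0 ?kT.
have T'0 : 0 < #|T'|.
  have /card_gt0P[[k i] qT] := T0; apply/card_gt0P; exists k.
  by rewrite inE; apply/card_gt0P; exists i; rewrite inE.
have T'T : #|T'| <= #|T|.
  by rewrite cardT -sum1_card; apply: leq_sum => k; rewrite inE.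
(* Only vertices of [W] can lie in several copies. If at most [g] copies are met, sparsity of [eh]
   applies to [T']. *)
have shared : \sum_v (\sum_k (0 < a k v) - 1) < #|T'|.
  rewrite big_sumType /= [X in _ + X]big1 ?addn0; last first.
    move=> [k x] _; rewrite (bigD1 k) //= [X in _ + X]big1; first by case: (0 < _).
    move=> k' k'k; rewrite /a big1 // => i _; apply/eqP; rewrite eqb0.
    by apply: contra k'k => /glue_edge_inr /= ->.
  have aw k w : 0 < a k (inl w) -> exists2 i, i \in Tk k & inl w \in glue_edge (k, i).
    rewrite lt0n sum_nat_eq0 negb_forall_in => /exists_inP[i iT].
    by rewrite eqb0 negbK; exists i.
  case: (leqP #|T'| g) => T'g.
    apply: leq_ltn_trans (sph T' _); last by rewrite T'0.
    apply: leq_sum => w _; apply: leq_sub2r.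
    rewrite [X in _ <= X]big_mkcond; apply: leq_sum => k _ /=.
    case: (boolP (k \in T')) => kT; last by rewrite a0.
    case: (posnP (a k (inl w))) => //= /aw[i _ /glue_edge_inl[x _ /b_mem /= ->]] //.
  have Tk1 k : #|Tk k| <= 1.
    rewrite leqNgt; apply/negP => Tk2; have kT : k \in T' by rewrite inE ltnW.
    suff : #|T'| < #|T| by rewrite ltnNge (leq_trans Tg).
    rewrite cardT -sum1_card (bigD1 k) //= [X in _ < X](bigD1 k) //= -addSn.
    by apply: leq_add => //; apply: leq_sum => k'; rewrite inE => /andP[].
  have total : \sum_w \sum_k (0 < a k (inl w)) <= #|T'|.
    rewrite exchange_big -sum1_card [X in _ <= X]big_mkcond /=.
    apply: leq_sum => k _; case: ifPn => kT; last first.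
      by rewrite big1 // => w _; rewrite a0.
    have -> : \sum_w (0 < a k (inl w)) = #|[set w | 0 < a k (inl w)]|.
      rewrite -sum1_card [RHS]big_mkcond.
      by apply: eq_bigr => w _; rewrite inE; case: (0 < _).
    apply/card_le1_eqP => w w'; rewrite !inE.
    move=> /aw[i iT /glue_edge_inl[/= x xe bx]] /aw[i' i'T /glue_edge_inl[/= x' xe' bx']].
    have ii : i' = i by move/card_le1_eqP: (Tk1 k); apply.
    rewrite ii in xe'; have xx : x = x'.
      by apply: (@b_edge k i) => //; [rewrite bx | rewrite bx'].
    by move: bx'; rewrite -xx bx => -[->].
  (* At a shared vertex that is used, the subtraction of 1 is not truncated, which makes the bound
     strict. *)
  case: (posnP (\sum_w \sum_k (0 < a k (inl w)))) => [/eqP|pos].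
    rewrite sum_nat_eq0 => /forallP z; rewrite big1 // => w _.
    by move: (z w) => /= /eqP ->.
  apply: leq_trans total.
  have [w cw] : exists w, 0 < \sum_k (0 < a k (inl w)).
    apply/existsP; apply: contraTT pos; rewrite negb_exists -leqNgt leqn0.
    by move=> /forallP z; rewrite sum_nat_eq0; apply/forallP => w; rewrite -leqn0 leqNgt z.
  rewrite (bigD1 w) //= [X in _ < X](bigD1 w) //= -addSn.
  apply: leq_add; last by apply: leq_sum => w' _; apply: leq_subr.
  by rewrite subn1 prednK.
apply: leq_ltn_trans (_ : \sum_k \sum_v (a k v - 1) +
                          \sum_v (\sum_k (0 < a k v) - 1) < _); last first.
  by rewrite -(subnK T'T) -addnS; apply: leq_add.
rewrite exchange_big -big_split; apply: leq_sum => v _.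
by rewrite sumT; apply: subn1_sum_le.
Qed.
End Glue.

(** Every edge of a [#|P|]-uniform hypergraph receives a copy of the system, glued along part [n]. A
    monochromatic edge [k] settles part [n] in copy [k], and the selection inside that copy settles
    [l]. Sparsity [g.+1] survives since an edge has at most one vertex in part [n]. *)
Lemma partite_system_glue (D N J : finType) (S : J -> {set N}) (g : nat)
    (n : N) (l : seq N) :
  (forall p, monochromatic_hypergraph D g p) ->
  partite_system D S g.+1 l -> partite_system D S g.+1 (n :: l).
Proof.
move=> hyp [V [I [pi [tau [e [pi_inj pi_im spe col]]]]]].
pose P := [set x | pi x == n].
have [W [K [eh [eh_card sph mono]]]] := hyp #|P|.
have /fin_all_exists[b bP] : forall k : K, exists b : V -> option W,
    [/\ forall x, isSome (b x) = (x \in P),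
        forall x y, b x = Some y -> y \in eh k &
        forall x x' y, b x = Some y -> b x' = Some y -> x = x'].
  by move=> k; apply: set_encoding; rewrite eh_card.
have b_some k x : isSome (b k x) = (pi x == n) by case: (bP k) => -> _ _; rewrite inE.
have b_mem k : forall x w, b k x = Some w -> w \in eh k by case: (bP k).
have b_inj k : forall x x' w, b k x = Some w -> b k x' = Some w -> x = x' by case: (bP k).
pose pi' (v : W + K * V) := if v is inr q then pi q.2 else n.
have pi'E k x : pi' (glue_vertex b k x) = pi x.
  rewrite /glue_vertex; case Ex: (b k x) => [w|] //=.
  by apply/esym/eqP; rewrite -(b_some k) Ex.
exists (W + K * V)%type, (K * I)%type, pi', (tau \o snd), (glue_edge e b); split.
- move=> [k i] _ _ /imsetP[x xe ->] /imsetP[y ye ->]; rewrite !pi'E => xy.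
  by rewrite (pi_inj i _ _ xe ye xy).
- move=> [k i] /=; rewrite -pi_im.
  rewrite /glue_edge -imset_comp. apply: eq_imset => x.
  by rewrite /= pi'E.
- apply: (glue_sparse b_inj b_mem _ spe sph) => k i x y xe ye.
  by rewrite !b_some => /eqP xn /eqP yn; apply: (pi_inj i) => //; rewrite xn.
- move=> chi; have [k [c kc]] := mono (fun w => chi (inl w)).
  have [f [ftau fl]] := col (fun x => chi (glue_vertex b k x)).
  exists (fun j => (k, f j)); split=> // m; rewrite inE.
  case/orP=> [/eqP ->|/fl[d fd]].
    exists c => j _ /imsetP[x xe ->]; rewrite pi'E /= => xn.
    have := b_some k x; rewrite xn eqxx /glue_vertex.
    by case Ex: (b k x) => [w|] // _; apply/kc/(b_mem k x).
  by exists d => j _ /imsetP[x xe ->]; rewrite pi'E => xm; apply: (fd j).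
Qed.

(** Treats the parts one by one. Hypergraphs of sparsity [g] suffice for systems of sparsity [g.+1]:
    this gain drives the induction on [g]. *)
Lemma partite_systemS (D N J : finType) (S : J -> {set N}) (g : nat) :
  (forall p, monochromatic_hypergraph D g p) ->
  partite_system D S g.+1 (enum N).
Proof.
move=> hyp; elim: (enum N) => [|n l]; last exact: partite_system_glue.
(* The start: pairwise disjoint edges, one of each type, so that no vertex has excess. *)
exists (J * N)%type, J, snd, id, (fun j => [set (j, x) | x in S j]); split.
- by move=> j _ _ /imsetP[x xS ->] /imsetP[y yS ->] /= ->.
- move=> j; rewrite -imset_comp -[RHS]imset_id.
  by apply: eq_imset.
- move=> T /andP[T0 _]; rewrite big1 // => -[j x] _; apply/eqP.
  rewrite subn_eq0.
  apply: leq_trans (_ : \sum_(i in T) (i == j) <= 1).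
    apply: leq_sum => i _; case: imsetP => // -[y _ [-> _]].
    by rewrite eqxx.
  by rewrite big_mkcond (bigD1 j) //= big1 ?eqxx;
     [case: ifP | move=> i /negbTE ->; case: ifP].
- by move=> chi; exists id.
Qed.

(** The types are all [p]-subsets of [p * #|D| + 1] parts. By pigeonhole some [p] parts share a
    colour, and the selected edge of that type is monochromatic. *)
Lemma partite_system_hypergraph (D : finType) (g : nat) :
  (forall (N J : finType) (S : J -> {set N}), partite_system D S g (enum N)) ->
  forall p, monochromatic_hypergraph D g p.
Proof.
move=> hyp p; pose N : finType := 'I_(p * #|D|).+1.
pose J : finType := {S : {set N} | #|S| == p}.
have [V [I [pi [tau [e [pi_inj pi_im spe col]]]]]] := hyp N J val.
exists V, I, e; split=> // [i|chi].
  by rewrite -(card_in_imset (pi_inj i)) pi_im; apply/eqP/(valP (tau i)).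
have [f [ftau fc]] := col chi.
have /fin_all_exists[chi0 chi0P] : forall n : N, exists c, forall j x,
    x \in e (f j) -> pi x = n -> chi x = c.
  by move=> n; apply: fc; rewrite mem_enum.
have [c pc] : exists c, p <= #|[set n | chi0 n == c]|.
  apply/existsP; apply: contraT; rewrite negb_exists => /forallP small.
  have : #|N| <= p * #|D|.
    rewrite -sum1_card (partition_big chi0 predT) //= [X in _ <= X]mulnC -sum_nat_const.
    apply: leq_sum => c _; apply: ltnW; rewrite ltnNge.
    by apply: contra (small c); rewrite -sum1dep_card.
  by rewrite card_ord ltnn.
have [A [AX Ap]] : exists A : {set N}, A \subset [set n | chi0 n == c] /\ #|A| == p.
  have := pc; rewrite -bin_gt0 -cards_draws => /card_gt0P[A].
  by rewrite inE => /andP[AX Ap]; exists A.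
pose j : J := exist _ A Ap.
exists (f j), c => x xe; have := chi0P _ _ _ xe erefl => ->.
have : pi x \in pi @: e (f j) by rewrite imset_f.
by rewrite pi_im ftau => /(subsetP AX); rewrite inE => /eqP.
Qed.

Lemma partite_system_exists (D : finType) (g : nat) (N J : finType) (S : J -> {set N}) :
  partite_system D S g (enum N).
Proof.
elim: g N J S => [|g IH] N J S; last first.
  by apply: partite_systemS; apply: partite_system_hypergraph; exact: IH.
(* At [g = 0] sparsity is vacuous, and each part can be a single vertex. *)
exists N, J, id, id, S; split=> [j x y _ _ //|j|T|chi].
- by rewrite imset_id.
- by case: (#|T|).
- by exists id; split=> // n _; exists (chi n) => j x _ /= ->.
Qed.

(** * Partial colourings and amalgamation *)

Section PartialColourings.
Variables (C : finType) (Es : list (ecgraph C)).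

(* A coloured graph on [V] as a partial function on pairs: [None] is a non-edge. *)
Definition pcol_free (V : finType) (w : V -> V -> option C) : Prop :=
  forall E, List.In E Es -> ~ exists h : gV (eg E) -> V,
    forall e : edge (eg E), w (h (val e).1) (h (val e).2) = Some (ecol E e).

Definition represents (G : graph) (gam : edge G -> C) (w : gV G -> gV G -> option C) :=
  (forall x y, gadj G x y = w x y :> bool) /\
  (forall e : edge G, w (val e).1 (val e).2 = Some (gam e)).

Lemma represents_free (G : graph) (gam : edge G -> C) w :
  represents gam w -> ec_free Es gam <-> pcol_free w.
Proof.
move=> [wadj wgam]; split=> free E EEs [h].
  move=> hh; apply: (free E EEs); exists h; split=> [x y xy|e e' ee'].
    by have := hh (exist _ (x, y) xy); rewrite wadj /= => ->.
  by have := hh e; have := wgam e'; rewrite ee' /= => -> [].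
case=> hG hcol; apply: (free E EEs); exists h => e.
pose e' : edge G := exist _ (h (val e).1, h (val e).2) (hG _ _ (valP e)).
by rewrite -(hcol e e') // -wgam.
Qed.

Lemma pcol_free_morph (V V' : finType) (w : V -> V -> option C)
    (w' : V' -> V' -> option C) (f : V -> V') :
  (forall x y c, w x y = Some c -> w' (f x) (f y) = Some c) ->
  pcol_free w' -> pcol_free w.
Proof.
move=> fh free E EEs [h hh]; apply: (free E EEs); exists (f \o h) => e.
exact: fh (hh e).
Qed.

Definition pcol_graph (V : finType) (w : V -> V -> option C)
    (ws : forall x y, w x y = w y x) (wi : forall x, w x x = None) : graph.
Proof.
apply: (@Graph V (fun x y => w x y)) => [x y|x]; [by rewrite ws | by rewrite wi].
Defined.

Lemma pcol_ecgraph (V : finType) (w : V -> V -> option C)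
    (ws : forall x y, w x y = w y x) (wi : forall x, w x x = None) :
  exists gam : edge (pcol_graph ws wi) -> C,
    ec_sym gam /\ @represents (pcol_graph ws wi) gam w.
Proof.
have /fin_all_exists[gam gamP] : forall e : edge (pcol_graph ws wi),
    exists c, w (val e).1 (val e).2 = Some c.
  by case=> -[x y] /=; case: (w x y) => // c _; exists c.
exists gam; split=> // e f ef fe; apply: Some_inj.
by rewrite -!gamP ef fe ws.
Qed.

Lemma ecol_pcol (G : graph) (gam : edge G -> C) : ec_sym gam ->
  exists w, [/\ represents gam w, forall x y, w x y = w y x & forall x, w x x = None].
Proof.
move=> gs; pose w (x y : gV G) : option C := omap gam (insub (x, y)).
have wadj x y : gadj G x y = w x y :> bool.
  by rewrite /w; case: insubP => [e /= -> //|/negbTE /= ->].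
have wgam (e : edge G) : w (val e).1 (val e).2 = Some (gam e).
  by rewrite /w -surjective_pairing valK.
exists w; split=> // [x y|x]; last by have := wadj x x; rewrite girr; case: (w x x).
rewrite /w; case: insubP => [e|]; case: insubP => [f|] //=.
- move=> _ fE _ eE; congr Some; have {}eE : val e = (x, y) := eE.
  by have {}fE : val f = (y, x) := fE; apply: gs; rewrite eE fE.
- by rewrite gsym => /negP.
- by move=> yx _ /negP[]; rewrite gsym.
Qed.

Hypothesis amalgamable :
  forall (X1 X2 : ecgraph C) (v1 : gV (eg X1)) (v2 : gV (eg X2))
          (gam : edge (amalgam v1 v2) -> C),
      ec_free Es (ecol X1) -> ec_free Es (ecol X2) ->
      amal_col (ecol X1) (ecol X2) gam -> ec_free Es gam.

(** The two sides share one vertex and there are no loops, so no edge comes from both and the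
    colours never conflict. *)
Lemma amal_col_exists (X1 X2 : ecgraph C) (v1 : gV (eg X1)) (v2 : gV (eg X2)) :
  exists gam : edge (amalgam v1 v2) -> C, amal_col (ecol X1) (ecol X2) gam.
Proof.
have disj (x1 y1 : gV (eg X1)) x2 y2 : gadj (eg X2) x2 y2 ->
    emb1 v2 x1 = emb2 v1 v2 x2 -> emb1 v2 y1 = emb2 v1 v2 y2 -> False.
  rewrite /emb1 /emb2; case: insubP => // /negPn/eqP ->.
  by case: insubP => // /negPn/eqP ->; rewrite girr.
have /fin_all_exists[gam gamP] : forall e : edge (amalgam v1 v2), exists c : C,
    (forall e1 : edge (eg X1),
       val e = (emb1 v2 (val e1).1, emb1 v2 (val e1).2) -> c = ecol X1 e1) /\
    (forall e2 : edge (eg X2),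
       val e = (emb2 v1 v2 (val e2).1, emb2 v1 v2 (val e2).2) -> c = ecol X2 e2).
  case=> -[a b] /= /orP[] /existsP[x /existsP[y /and3P[xy /eqP -> /eqP ->]]].
    exists (ecol X1 (exist _ (x, y) xy)); split=> [e1 [ex ey]|e2 [ex ey]].
      congr ecol; apply: val_inj; rewrite /= ex ey.
      by case: (val e1).
    by case: (disj _ _ _ _ (valP e2) ex ey).
  exists (ecol X2 (exist _ (x, y) xy)); split=> [e1 [ex ey]|e2 [ex ey]].
    by case: (disj _ _ _ _ xy (esym ex) (esym ey)).
  congr ecol; apply: val_inj; rewrite /= (emb2_inj ex) (emb2_inj ey).
  by case: (val e2).
by exists gam; split=> e' e ee; apply (gamP e).
Qed.

(** Both graphs live on all of [V]. Two copies of [V] are amalgamated at the common vertex [v], and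
    [rho] carries the coloured edges of [w] into the amalgam. *)
Lemma pcol_free_union (V : finType) (w w1 w2 : V -> V -> option C) (A B : {set V}) :
  (forall x y, w1 x y = w1 y x) -> (forall x, w1 x x = None) ->
  (forall x y, w2 x y = w2 y x) -> (forall x, w2 x x = None) ->
  (forall x y, w1 x y -> x \in A) -> (forall x y, w2 x y -> x \in B) ->
  #|A :&: B| <= 1 ->
  (forall x y c, w x y = Some c -> w1 x y = Some c \/ w2 x y = Some c) ->
  pcol_free w1 -> pcol_free w2 -> pcol_free w.
Proof.
move=> s1 i1 s2 i2 A1 B2 AB w12 free1 free2 E EEs [h hh].
(* If [E] has no edge, [h] contradicts [free1] at once; otherwise an edge supplies a default for [v]
   when [A] and [B] are disjoint. *)
case: (pickP (fun e : edge (eg E) => true)) => [e0 _|noedge]; last first.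
  by apply: (free1 E EEs); exists h => e; have := noedge e.
have [v vP] : exists v, forall x, x \in A -> x \in B -> x = v.
  case: (pickP (mem (A :&: B))) => [v vAB|none].
    by exists v => x xA xB; apply: (card_le1_eqP AB) => //; rewrite inE xA.
  exists (h (val e0).1) => x xA xB; have := none x.
  by rewrite /= inE xA xB.
have [g1 [gs1 r1]] := pcol_ecgraph s1 i1.
have [g2 [gs2 r2]] := pcol_ecgraph s2 i2.
pose X1 := ECGraph gs1; pose X2 := ECGraph gs2.
have [gam gamP] := @amal_col_exists X1 X2 v v.
have f1 : ec_free Es (ecol X1) by apply/(represents_free r1).
have f2 : ec_free Es (ecol X2) by apply/(represents_free r2).
have free := amalgamable f1 f2 gamP.
pose rho (x : V) : @amal_V (eg X1) (eg X2) v :=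
  if x \in A then @emb1 (eg X1) (eg X2) v x
  else @emb2 (eg X1) (eg X2) v v x.
have emb1v x y c : w1 x y = Some c -> rho x = @emb1 (eg X1) (eg X2) v x.
  by move=> xy; rewrite /rho (A1 x y) ?xy.
(* An endpoint of a [w2]-edge that lies in [A] is [v], where both embeddings agree. *)
have emb2v x y c : w2 x y = Some c -> rho x = @emb2 (eg X1) (eg X2) v v x.
  move=> xy; rewrite /rho; case: ifP => // xA.
  by rewrite (vP x xA) ?(B2 x y) ?xy // /emb2 insubF // eqxx.
have key (e : edge (eg E)) :
    gadj (amalgam (v : gV (eg X1)) (v : gV (eg X2)))
      (rho (h (val e).1)) (rho (h (val e).2)) /\
    forall e', val e' = (rho (h (val e).1), rho (h (val e).2)) -> gam e' = ecol E e.
  case: (w12 _ _ _ (hh e)) => we.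
    rewrite (emb1v _ _ _ we); rewrite s1 in we.
    rewrite (emb1v _ _ _ we); rewrite s1 in we.
    have xy : gadj (eg X1) (h (val e).1) (h (val e).2) by rewrite /= we.
    split=> [|e' e'E].
      apply/orP; left; apply/existsP; exists (h (val e).1).
      by apply/existsP; exists (h (val e).2); rewrite xy !eqxx.
    rewrite (gamP.1 (exist _ (_, _) xy) e' e'E); apply: Some_inj.
    by rewrite -we; symmetry; exact: (r1.2 (exist _ (_, _) xy)).
  rewrite (emb2v _ _ _ we); rewrite s2 in we.
  rewrite (emb2v _ _ _ we); rewrite s2 in we.
  have xy : gadj (eg X2) (h (val e).1) (h (val e).2) by rewrite /= we.
  split=> [|e' e'E].
    apply/orP; right; apply/existsP; exists (h (val e).1).
    by apply/existsP; exists (h (val e).2); rewrite xy !eqxx.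
  rewrite (gamP.2 (exist _ (_, _) xy) e' e'E); apply: Some_inj.
  by rewrite -we; symmetry; exact: (r2.2 (exist _ (_, _) xy)).
apply: (free E EEs); exists (rho \o h); split=> [x y xy|e e' e'E].
  exact: (key (exist _ (x, y) xy)).1.
exact: (key e).2 e' e'E.
Qed.
End PartialColourings.

(** * Colourings glued along a sparse hypergraph *)

Section GluedColourings.
Variables (C : finType) (Es : list (ecgraph C)).

Hypothesis amalgamable :
  forall (X1 X2 : ecgraph C) (v1 : gV (eg X1)) (v2 : gV (eg X2))
          (gam : edge (amalgam v1 v2) -> C),
      ec_free Es (ecol X1) -> ec_free Es (ecol X2) ->
      amal_col (ecol X1) (ecol X2) gam -> ec_free Es gam.

Hypothesis edgeless_free : forall V : finType, pcol_free Es (fun _ _ : V => None).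

Variables (V I : finType) (e : I -> {set V}) (u : I -> V -> V -> option C).
Hypothesis u_sym : forall i x y, u i x y = u i y x.
Hypothesis u_irr : forall i x, u i x x = None.
Hypothesis u_free : forall i, pcol_free Es (u i).

Definition carrier (x y : V) : option I := [pick i | (x \in e i) && (y \in e i)].

(* A pair is coloured by one chosen edge [carrier x y] containing it, so that the
   restrictions to different [T] are compatible. *)
Definition glued (T : {set I}) (x y : V) : option C :=
  if carrier x y is Some i then if i \in T then u i x y else None else None.

Lemma glued_sym T x y : glued T x y = glued T y x.
Proof.
have -> : glued T x y = if carrier y x is Some i then
    if i \in T then u i x y else None else None.
  by rewrite /glued /carrier; under eq_pick => i do rewrite andbC.
by rewrite /glued; case: (carrier y x) => // i; rewrite u_sym.
Qed.

Lemma glued_irr T x : glued T x x = None.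
Proof. by rewrite /glued; case: carrier => // i; rewrite u_irr if_same. Qed.

Lemma glued_mem T x y : glued T x y -> exists2 i, i \in T & x \in e i.
Proof.
rewrite /glued /carrier; case: pickP => // i /andP[xi _].
by case: ifP => // iT _; exists i.
Qed.

(** Induction on [#|T|]: a leaf edge meets the others in at most one vertex, so [pcol_free_union]
    adds it back. *)
Lemma glued_small_free (g : nat) (T : {set I}) :
  sparse g e -> #|T| <= g -> pcol_free Es (glued T).
Proof.
move=> sp; move: {2}#|T| (leqnn #|T|) => n; elim: n T => [|n IH] T Tn Tg.
  move: Tn; rewrite leqn0 cards_eq0 => /eqP ->.
  apply: (pcol_free_morph (f := id)) (@edgeless_free V) => x y c.
  by rewrite /glued; case: carrier => // i; rewrite in_set0.
case: (posnP #|T|) => [T0|T0]; first by apply: IH; rewrite T0.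
have [|i iT leaf] := @sparse_leaf g V I e T sp; first by rewrite T0.
have Ti : #|T| = #|T :\ i|.+1 by rewrite (cardsD1 i T) iT.
have free2 : pcol_free Es (glued (T :\ i)) by apply: IH; lia.
have free1 : pcol_free Es (glued [set i]).
  apply: (pcol_free_morph (f := id)) (@u_free i) => x y c.
  by rewrite /glued; case: carrier => // k; rewrite inE; case: eqP => // ->.
apply: (pcol_free_union amalgamable (glued_sym _) (glued_irr _) (glued_sym _)
         (glued_irr _) _ _ leaf _ free1 free2) => [x y /glued_mem[k]|x y /glued_mem[k kT xk]|x y c].
- by rewrite inE => /eqP ->.
- by apply/bigcupP; exists k.
- rewrite /glued; case: carrier => // k; rewrite in_set1 in_setD1.
  by case: (k \in T) => // ->; case: eqP; [left|right].
Qed.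

(** The image of [E] uses at most one carrier per ordered edge of [E], hence lies in [glued T] for
    some [T] of at most [g] edges. *)
Lemma glued_free (g : nat) :
  sparse g e -> (forall E, List.In E Es -> #|{: edge (eg E)}| <= g) ->
  pcol_free Es (glued setT).
Proof.
move=> sp Eg E EEs [h hh].
pose c (d : edge (eg E)) := carrier (h (val d).1) (h (val d).2).
pose T := [set i | [exists d, c d == Some i]].
have Tg : #|T| <= g.
  apply: leq_trans (Eg E EEs).
  have Some_injI : injective (@Some I) by move=> i j [].
  rewrite -(card_imset _ Some_injI); apply: leq_trans (leq_imset_card c _).
  apply/subset_leq_card/subsetP => _ /imsetP[i + ->].
  by rewrite inE => /existsP[d /eqP <-]; rewrite imset_f.
apply: (glued_small_free sp Tg EEs); exists h => d.
rewrite -(hh d) /glued -/(c d); case cd: (c d) => [i|] //.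
by rewrite !inE; case: existsP => // -[]; exists d; rewrite cd.
Qed.
End GluedColourings.

(** * Small induced subgraphs and the final contradiction *)

Definition induced (G : graph) (S : {set gV G}) : graph.
Proof.
apply: (@Graph {x | x \in S} (fun a b => gadj G (val a) (val b))) => [a b|a].
  by rewrite gsym.
by rewrite girr.
Defined.

Lemma induced_pcol (C : finType) (Es : list (ecgraph C)) (G : graph) (S : {set gV G}) :
  (forall V : finType, pcol_free Es (fun _ _ : V => None)) -> ColE Es (induced S) ->
  exists w : gV G -> gV G -> option C,
    [/\ forall x y, w x y = w y x, forall x, w x x = None, pcol_free Es w &
        forall x y, x \in S -> y \in S -> gadj G x y -> w x y].
Proof.
move=> edgeless [gam [gs free]].
have [w0 [r0 s0 i0]] := ecol_pcol gs.
have free0 : pcol_free Es w0 by apply/(represents_free _ r0).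
pose w x y : option C :=
  if insub x is Some a then if insub y is Some b then w0 a b else None else None.
exists w; split=> [x y|x||x y xS yS xy].
- by rewrite /w; case: insub => [a|]; case: insub => [b|].
- by rewrite /w; case: insub => [a|] //; rewrite i0.
(* All coloured pairs lie inside [S], so the other vertices may be sent to any [s] in [S]. *)
- case: (pickP (mem S)) => [s sS|S0].
    apply: (pcol_free_morph (f := insubd (exist _ s sS))) free0 => x y c.
    by rewrite /w /insubd; case: insub => [a|] //; case: insub.
  apply: (pcol_free_morph (f := id)) (@edgeless (gV G)) => x y c.
  by rewrite /w insubF //; exact: S0.
- by rewrite /w !insubT -r0.1.
Qed.

Lemma list_bound (T : Type) (f : T -> nat) (l : list T) :
  exists n, forall x, List.In x l -> f x <= n.
Proof.
elim: l => [|a l [n hn]]; first by exists 0.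
exists (maxn (f a) n) => x /= [<-|/hn xl]; first exact: leq_maxl.
by rewrite leq_max xl orbT.
Qed.

Theorem theorem4 (C : finType) (Es : list (ecgraph C)) :
  (* (1) Es-free edge-coloured graphs are closed under amalgamation over vertices *)
  (forall (X1 X2 : ecgraph C) (v1 : gV (eg X1)) (v2 : gV (eg X2))
          (gam : edge (amalgam v1 v2) -> C),
      ec_free Es (ecol X1) -> ec_free Es (ecol X2) ->
      amal_col (ecol X1) (ecol X2) gam -> ec_free Es gam) ->
  (* (2) *)
  (forall K : nat, 1 <= K ->
     exists G : graph, ~ ColE Es G /\
       forall H : graph, #|gV H| <= K -> subgraph H G -> ColE Es H) ->
  ~ exists (D : finType) (Fs : list (vcgraph D)),
      forall G : graph, ColF Fs G <-> ColE Es G.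
Proof.
move=> amalgamable sparse_obstruction [D [Fs FsEs]].
have induced_col K (G : graph) (S : {set gV G}) :
    (forall H : graph, #|gV H| <= K -> subgraph H G -> ColE Es H) ->
    #|S| <= K -> ColE Es (induced S).
  move=> small SK; apply: small; first by rewrite card_sig.
  by exists val; split; [exact: val_inj | move=> x y].
(* Hypothesis (2) with [K = 1] gives a nonempty graph, one vertex of which is free; every edgeless
   graph maps to that vertex. *)
have edgeless (V : finType) : pcol_free Es (fun _ _ : V => None).
  have [G [nG small]] := sparse_obstruction 1 isT.
  case: (pickP (fun x : gV G => true)) => [x _|G0]; last first.
    case: nG; apply: small; first by rewrite (eq_card0 G0).
    by exists id; split.
  have [|gam [gs free]] := induced_col 1 G [set x] small; first by rewrite cards1.
  have [w [r _ _]] := ecol_pcol gs.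
  have {}free : pcol_free Es w by apply/(represents_free _ r).
  by apply: (pcol_free_morph (f := fun=> exist _ x (set11 x))) free.
have [g Eg] := list_bound (fun E => #|{: edge (eg E)}|) Es.
have [K FK] := list_bound (fun F => #|gV (vg F)|) Fs.
have [G [nG small]] := sparse_obstruction K.+1 isT.
pose J : finType := {S : {set gV G} | #|S| <= K.+1}.
have /fin_all_exists[w wP] : forall j : J, exists w : gV G -> gV G -> option C,
    [/\ forall x y, w x y = w y x, forall x, w x x = None, pcol_free Es w &
        forall x y, x \in val j -> y \in val j -> gadj G x y -> w x y].
  move=> j; apply: induced_pcol => //.
  exact: (induced_col K.+1) small (valP j).
(* The parts are the vertices of [G], the types its small vertex sets. *)
have [V [I [pi [tau [e [pi_inj pi_im sp col]]]]]] :=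
  partite_system_exists D g (val : J -> {set gV G}).
pose u i x y := w (tau i) (pi x) (pi y).
have u_sym i x y : u i x y = u i y x by have [ws _ _ _] := wP (tau i); exact: ws.
have u_irr i x : u i x x = None by have [_ wi _ _] := wP (tau i); exact: wi.
have u_free i : pcol_free Es (u i).
  by apply: (@pcol_free_morph _ _ _ _ _ (w (tau i)) pi) => //; case: (wP (tau i)).
have free := glued_free amalgamable edgeless u_sym u_irr u_free sp Eg.
pose H := pcol_graph (glued_sym e u_sym setT) (glued_irr e u_irr setT).
have : ColE Es H.
  have [gam [gs r]] := pcol_ecgraph (glued_sym e u_sym setT) (glued_irr e u_irr setT).
  by exists gam; split=> //; apply/(represents_free _ r).
case/FsEs=> chi chi_free; apply/nG/FsEs.
have [f [ftau fc]] := col chi.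
(* A vertex of [G] gets the colour that [chi] takes on its part throughout the selected edges. *)
have /fin_all_exists[chi0 chi0P] : forall n : gV G, exists c, forall j x,
    x \in e (f j) -> pi x = n -> chi x = c.
  by move=> n; apply: fc; rewrite mem_enum.
exists chi0 => F FFs [h [hh hc]]; apply: (chi_free F FFs).
have SK : #|h @: [set: gV (vg F)]| <= K.+1.
  by apply: leq_trans (leq_imset_card _ _) _; rewrite cardsT ltnW // ltnS FK.
(* The image of [h] is a type, and [h] lifts to the selected edge of that type. *)
pose j : J := Sub (h @: [set: gV (vg F)]) SK.
have /fin_all_exists[h' h'P] : forall x, exists y, y \in e (f j) /\ pi y = h x.
  move=> x; have : h x \in pi @: e (f j) by rewrite pi_im ftau SubK imset_f.
  by case/imsetP=> y ye ->; exists y.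
exists h'; split=> [x y xy|x]; last first.
  by rewrite (chi0P (h x) j) ?hc //; case: (h'P x).
have [[xe xh] [ye yh]] := (h'P x, h'P y).
(* The carrier [i] may differ from [f j], but its type also contains [h x] and [h y], and
   [w (tau i)] colours all edges of [G] inside its type. *)
rewrite /= /glued /carrier; case: pickP => [i /andP[xi yi]|/(_ (f j))]; last by rewrite xe ye.
rewrite inE /u; have [_ _ _ wadj] := wP (tau i).
by apply: wadj; rewrite -?pi_im ?imset_f // xh yh; apply: hh.
Qed.
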